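(* Let $p$ be a prime and let $G=Q_{4p}$. Then $E(\mathcal{B}(G))<LE(\mathcal{B}(G))=LE^+(\mathcal{B}(G))$.
   Context: $Q_{4m}=\langle a,b : a^{2m}=1,\ b^2=a^m,\ bab^{-1}=a^{-1}\rangle$ is the dicyclic group of order $4m$. For a finite group $G$, let $L(G)$ be the set of all subgroups of $G$. The subgroup generating bipartite graph $\mathcal{B}(G)$ is the simple bipartite graph with vertex set the disjoint union of $G\times G$ and $L(G)$, in which $(a,b)\in G\times G$ and $H\in L(G)$ are adjacent if and only if $H$ is the subgroup generated by $a$ and $b$ (and there are no other edges). For a finite simple graph $\Gamma$ with $n$ vertices and $m$ edges, let $A$ be its adjacency matrix and $D$ its diagonal degree matrix. The energy $E(\Gamma)$ is the sum of absolute values of the eigenvalues of $A$. The Laplacian energy is $LE(\Gamma)=\sum_{\lambda}|\lambda-\frac{2m}{n}|$ over the eigenvalues $\lambda$ of $D-A$, and the signless Laplacian energy is $LE^+(\Gamma)=\sum_{\mu}|\mu-\frac{2m}{n}|$ over the eigenvalues $\mu$ of $D+A$ (all counted with multiplicity). *)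

(* Defs.v *)
From HB Require Import structures.
From mathcomp Require Import all_boot all_order all_fingroup all_algebra all_field.

Set Implicit Arguments.
Unset Strict Implicit.
Unset Printing Implicit Defensive.

Import Order.TTheory GRing.Theory Num.Theory.

Local Open Scope ring_scope.

Record sgraph := SGraph {
  svertex :> finType;
  sedge : rel svertex;
  sedge_sym : symmetric sedge;
  sedge_irrefl : irreflexive sedge }.

Section GraphEnergies.

Variable Gamma : sgraph.

Definition edges : {set {set Gamma}} :=
  [set [set u.1; u.2] | u : Gamma * Gamma & sedge u.1 u.2].

Definition degree (x : Gamma) : nat := #|[set y | sedge x y]|.

Definition adjacency_mx : 'M[algC]_#|Gamma| :=
  \matrix_(i, j) (sedge (enum_val i) (enum_val j))%:R.

Definition degree_mx : 'M[algC]_#|Gamma| :=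
  diag_mx (\row_i (degree (enum_val i))%:R).

End GraphEnergies.

(* The roots of the characteristic polynomial, listed with their algebraic
   multiplicities; algC suffices because the matrices above have integer
   entries. *)
Definition eigenvalues n (M : 'M[algC]_n) : seq algC :=
  sval (closed_field_poly_normal (char_poly M)).

Lemma eigenvaluesP n (M : 'M[algC]_n) :
  char_poly M = \prod_(z <- eigenvalues M) ('X - z%:P).
Proof.
rewrite /eigenvalues; case: closed_field_poly_normal => r /= Dr.
by rewrite {1}Dr (monicP (char_poly_monic M)) scale1r.
Qed.

Definition average_degree (Gamma : sgraph) : algC :=
  (2 * #|edges Gamma|)%:R / #|Gamma|%:R.

Definition energy (Gamma : sgraph) : algC :=
  \sum_(z <- eigenvalues (adjacency_mx Gamma)) `|z|.

Definition laplacian_energy (Gamma : sgraph) : algC :=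
  \sum_(z <- eigenvalues (degree_mx Gamma - adjacency_mx Gamma))
    `|z - average_degree Gamma|.

Definition signless_laplacian_energy (Gamma : sgraph) : algC :=
  \sum_(z <- eigenvalues (degree_mx Gamma + adjacency_mx Gamma))
    `|z - average_degree Gamma|.

(* A finite group is a whole finGroupType gT, so L(G) is the type {group gT}. *)
Section SubgroupGeneratingBipartiteGraph.

Variable gT : finGroupType.

Definition sgb_vertex : finType := ((gT * gT) + {group gT})%type.

Definition sgb_edge : rel sgb_vertex := fun u v =>
  match u, v with
  | inl ab, inr H | inr H, inl ab => H :==: <<[set ab.1; ab.2]>>%g
  | _, _ => false
  end.

Lemma sgb_edge_sym : symmetric sgb_edge.
Proof. by case=> [ab|H] [cd|K]. Qed.

Lemma sgb_edge_irrefl : irreflexive sgb_edge.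
Proof. by case. Qed.

Definition sgb_graph : sgraph := SGraph sgb_edge_sym sgb_edge_irrefl.

End SubgroupGeneratingBipartiteGraph.

(* mathcomp's 'Q_n is meaningful only for n a power of 2, hence the
   presentation. As <a, b> is finite, \isog Grp is isomorphism with it. *)
Definition dicyclic (gT : finGroupType) (m : nat) : Prop :=
  ([set: gT] \isog Grp (a : b :
     a ^+ (2 * m) = 1, b ^+ 2 = a ^+ m, b * a * b^-1 = a^-1))%g.

(* Main.v *)
Require Import Defs.
From mathcomp Require Import all_boot all_order all_fingroup all_algebra all_field.
From mathcomp Require Import ring.

Set Implicit Arguments.
Unset Strict Implicit.
Unset Printing Implicit Defensive.

Import Order.TTheory GRing.Theory Num.Theory.

(** Every pair (a, b) has exactly one neighbour, the subgroup it generates, so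
    B(G) is a disjoint union of stars: one for each subgroup H, with d_H leaves,
    where d_H is the number of pairs generating H.  Spectra of stars are
    explicit.  When d_H > 0, the star of H contributes sqrt d_H, - sqrt d_H and
    d_H - 1 times 0 to the adjacency spectrum; it contributes 0, d_H + 1 and
    d_H - 1 times 1 to both Laplacian spectra.  An isolated H contributes 0
    everywhere.  Hence LE = LE^+, and writing c for the average degree,
      E = sum_H 2 sqrt d_H,
      LE = sum_H ((d_H - 1) |1 - c| + |c| + |d_H + 1 - c|).
    The comparison is made star by star: for d_H > 0,
      2 sqrt d_H <= d_H + 1 <= |c| + |d_H + 1 - c|
    by the inequality of arithmetic and geometric means and the triangle
    inequality, and for d_H = 0 the two terms are 0 and |c|.  The first
    inequality is strict as soon as d_H > 1, which happens for H = <x> with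
    x <> 1, since both (x, 1) and (1, x) generate it.  The group Q_4p
    contains such an x because Z/2 satisfies the relations of its presentation
    and is therefore one of its quotients.

    All three spectra come from one computation
    ([char_poly_function_graph]), for matrices supported on the graph of an
    arbitrary function phi : S -> T, with diagonal constant on S and arbitrary
    on T. *)

Local Open Scope ring_scope.

(** * Characteristic polynomials of bipartite block matrices *)

Lemma det_mxsub_bij (R : comNzRingType) m n (f : 'I_m -> 'I_n) (A : 'M[R]_n) :
  bijective f -> \det (mxsub f f A) = \det A.
Proof.
move=> bij_f; have eq_mn: m = n.
  by rewrite -(card_ord m) (bij_eq_card bij_f) card_ord.
case: n / eq_mn f A bij_f => f A bij_f.
pose s := perm (bij_inj bij_f).
have -> : mxsub f f A = perm_mx s *m A *m (perm_mx s)^T.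
  rewrite tr_perm_mx -col_permE -row_permE.
  by apply/matrixP=> i j; rewrite !mxE !permE.
by rewrite !det_mulmx det_tr mulrAC det_perm -signr_addb addbb mul1r.
Qed.

Lemma char_poly_mxsub_bij (R : comNzRingType) m n (f : 'I_m -> 'I_n)
  (A : 'M[R]_n) : bijective f -> char_poly (mxsub f f A) = char_poly A.
Proof.
move=> bij_f; rewrite /char_poly -(det_mxsub_bij _ bij_f); congr (\det _).
by apply/matrixP=> i j; rewrite !mxE (inj_eq (bij_inj bij_f)).
Qed.

(** A Schur complement without division: multiplying the characteristic matrix
    on the right by [1, s B; 0, 'X - a] clears its upper right block.  The
    factor ('X - a)^l that this introduces is left in the statement, because
    cancelling it would force a comparison of l with N. *)
Lemma char_poly_block_diag (R : comNzRingType) N l (a s : R)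
    (B : 'M[R]_(N, l)) (d e : 'rV[R]_l) :
  B^T *m B = diag_mx d ->
  char_poly (block_mx a%:M (s *: B) (s *: B^T) (diag_mx e)) * ('X - a%:P) ^+ l
  = ('X - a%:P) ^+ N *
    \prod_j (('X - a%:P) * ('X - (e 0 j)%:P) - (s ^+ 2 * d 0 j)%:P).
Proof.
move=> BTB; set u := 'X - a%:P.
pose C := map_mx polyC (s *: B).
have CTC : C^T *m C = diag_mx (\row_j (s ^+ 2 * d 0 j)%:P).
  rewrite map_trmx -map_mxM linearZ /= [(_ *: B)^T]linearZ /=.
  rewrite -scalemxAl scalerA BTB.
  by apply/matrixP=> i j; rewrite !mxE mulrnAr polyCMn expr2.
have -> : char_poly (block_mx a%:M (s *: B) (s *: B^T) (diag_mx e)) =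
    \det (block_mx u%:M (- C) (- C^T) (diag_mx (\row_j ('X - (e 0 j)%:P)))).
  rewrite /char_poly /char_poly_mx map_block_mx scalar_mx_block opp_block_mx.
  rewrite add_block_mx !add0r map_trmx linearZ /= map_scalar_mx -raddfB /=.
  congr (\det (block_mx _ _ _ _)); apply/matrixP=> i j; rewrite !mxE polyCMn.
  by rewrite mulrnBl.
have -> : u ^+ l = \det (block_mx 1%:M C 0 u%:M).
  by rewrite det_ublock det1 mul1r det_scalar.
rewrite -det_mulmx mulmx_block !mulmx1 !mulmx0 !addr0.
rewrite mul_scalar_mx mul_mx_scalar scalerN subrr det_lblock det_scalar.
congr (_ * _); rewrite mulNmx CTC mul_mx_scalar -[RHS]mul1r.
rewrite [X in \det X](_ : _ = diag_mx
  (\row_j (u * ('X - (e 0 j)%:P) - (s ^+ 2 * d 0 j)%:P))).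
  by rewrite det_diag mul1r; apply: eq_bigr => j _; rewrite mxE.
by apply/matrixP=> i j; rewrite !mxE [RHS]mulrnBl mulrnAr addrC.
Qed.

(** * Matrices on the graph of a function *)

Section FunctionGraph.

Variables (S T : finType) (phi : S -> T).

Definition fibre_card (t : T) : nat := #|[set x | phi x == t]|.

(** With (a, s, e) equal to (0, 1, 0), (1, 0, d) and (1, +-1, d), where d is the
    size of the fibre, these are the adjacency matrix, the degree matrix and
    the two Laplacians of the bipartite graph joining each x to phi x. *)
Definition function_graph_mx (R : nzRingType) (a s : R) (e : T -> R) :
    'M[R]_#|{: S + T}| :=
  \matrix_(i, j) match enum_val i, enum_val j with
  | inl x, inl y => a *+ (x == y)
  | inl x, inr t | inr t, inl x => s *+ (phi x == t)
  | inr t, inr u => e t *+ (t == u)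
  end.

Lemma char_poly_function_graph (R : comNzRingType) (a s : R) (e : T -> R) :
  char_poly (function_graph_mx a s e) * ('X - a%:P) ^+ #|T|
  = ('X - a%:P) ^+ #|S| *
    \prod_t (('X - a%:P) * ('X - (e t)%:P) - (s ^+ 2 *+ fibre_card t)%:P).
Proof.
pose f (i : 'I_(#|S| + #|T|)) : 'I_#|{: S + T}| :=
  enum_rank (match split i with
             | inl j => inl (enum_val j) | inr k => inr (enum_val k) end).
pose g (i : 'I_#|{: S + T}|) : 'I_(#|S| + #|T|) :=
  unsplit (match enum_val i with
           | inl x => inl (enum_rank x) | inr t => inr (enum_rank t) end).
have bij_f : bijective f.
  exists g => i; rewrite /f /g.
    by rewrite enum_rankK -[RHS]splitK; case: (split i) => k; rewrite enum_valK.
  apply: enum_val_inj; rewrite enum_rankK unsplitK.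
  by case: (enum_val i) => k; rewrite enum_rankK.
pose B : 'M[R]_(#|S|, #|T|) :=
  \matrix_(i, j) (phi (enum_val i) == enum_val j)%:R.
have BTB : B^T *m B = diag_mx (\row_j (fibre_card (enum_val j))%:R).
  (* Columns of B are indicators of fibres, and distinct fibres are disjoint. *)
  apply/matrixP=> j k; rewrite !mxE.
  under eq_bigr => i _ do rewrite !mxE -natrM mulnb.
  rewrite -natr_sum -(big_enum_val (A := S)
    (fun x => ((phi x == enum_val j) && (phi x == enum_val k) : nat))) /=.
  case: (eqVneq j k) => [<- | ne_jk].
    rewrite mulr1n /fibre_card -sum1_card big_mkcond /=; congr _%:R.
    rewrite [RHS]big_mkcond /=; apply: eq_bigr => x _.
    by rewrite inE andbb; case: eqP.
  rewrite mulr0n big1 // => x _; case: (eqVneq (phi x) (enum_val j)) => // ->.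
  by rewrite (inj_eq enum_val_inj) (negPf ne_jk).
rewrite -(char_poly_mxsub_bij _ bij_f).
have -> : mxsub f f (function_graph_mx a s e) =
    block_mx a%:M (s *: B) (s *: B^T) (diag_mx (\row_j e (enum_val j))).
  apply/matrixP=> i j; rewrite !mxE !enum_rankK.
  case: (split i) => k; rewrite mxE; case: (split j) => h;
    by rewrite !mxE ?(inj_eq enum_val_inj) ?mulr_natr.
rewrite (char_poly_block_diag _ _ _ BTB); congr (_ * _).
rewrite [RHS](reindex _ (onW_bij _ (@enum_val_bij T))) /=.
apply: eq_bigr => j _; by rewrite !mxE mulr_natr.
Qed.

Lemma function_graph_mxDZ (R : nzRingType) (a s : R) (e : T -> R) :
  function_graph_mx a 0 e + s *: function_graph_mx 0 1 (fun=> 0)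
  = function_graph_mx a s e.
Proof.
apply/matrixP=> i j; rewrite !mxE.
by case: (enum_val i) => x; case: (enum_val j) => y;
  rewrite ?mul0rn ?mulr0 ?addr0 ?add0r ?mulr_natr.
Qed.

End FunctionGraph.

(** * Sums over eigenvalues *)

(** Sums over the spectrum can be read off any factorization of a multiple of
    the characteristic polynomial, which is how the cofactor ('X - a)^l
    disappears. *)
Lemma sum_eigenvalues_cofactor n (M : 'M[algC]_n) (V : nmodType)
    (F : algC -> V) (r s : seq algC) :
  char_poly M * \prod_(z <- r) ('X - z%:P) = \prod_(z <- s) ('X - z%:P) ->
  \sum_(z <- eigenvalues M) F z + \sum_(z <- r) F z = \sum_(z <- s) F z.
Proof.
rewrite eigenvaluesP -!big_cat /=; set t := eigenvalues M ++ r => eq_ts.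
by apply: perm_big; apply: prod_XsubC_eq.
Qed.

(** The factor at t is the quadratic ('X - p t)('X - q t), given by Vieta's
    formulas in the two hypotheses. *)
Lemma sum_eigenvalues_function_graph (S T : finType) (phi : S -> T)
    (a s : algC) (e : T -> algC) (p q : T -> algC) (V : nmodType)
    (F : algC -> V) :
  (forall t, p t + q t = a + e t) ->
  (forall t, p t * q t = a * e t - s ^+ 2 *+ fibre_card phi t) ->
  \sum_(z <- eigenvalues (function_graph_mx phi a s e)) F z + F a *+ #|T|
  = F a *+ #|S| + \sum_t (F (p t) + F (q t)).
Proof.
move=> sum_pq prod_pq.
have F_nseq k : \sum_(z <- nseq k a) F z = F a *+ k.
  by rewrite big_nseq -Monoid.iteropE.
rewrite -F_nseq -(F_nseq #|S|).
have -> : \sum_t (F (p t) + F (q t)) =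
    \sum_(z <- flatten [seq [:: p t; q t] | t <- enum T]) F z.
  rewrite big_flatten big_map big_enum /=; apply: eq_bigr => t _.
  by rewrite big_cons big_seq1.
rewrite -[RHS]big_cat /=; apply: sum_eigenvalues_cofactor.
have prod_nseq k : \prod_(z <- nseq k a) ('X - z%:P) = ('X - a%:P) ^+ k.
  by rewrite big_nseq -Monoid.iteropE.
rewrite big_cat !prod_nseq char_poly_function_graph; congr (_ * _).
rewrite big_flatten big_map big_enum /=; apply: eq_bigr => t _.
have Ee : e t = p t + q t - a by rewrite sum_pq addrC addKr.
have -> : s ^+ 2 *+ fibre_card phi t = a * e t - p t * q t.
  by rewrite prod_pq opprB addrC subrK.
by rewrite big_cons big_seq1 Ee; ring.
Qed.

(** * The energies of the subgroup generating bipartite graph *)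

(** A star with d leaves has Laplacian eigenvalues 0, d + 1 and d - 1 times 1,
    hence this contribution to the Laplacian energy when c is the average
    degree.
    For d = 0 the eigenvalue 1 occurs with multiplicity -1, which cancels the
    term of d + 1 and leaves the single eigenvalue 0. *)
Definition star_laplacian_term (c : algC) (d : nat) : algC :=
  `|1 - c| *+ d - `|1 - c| + (`|c| + `|d.+1%:R - c|).

Section SubgroupGeneratingBipartiteGraph.

Variable gT : finGroupType.

Definition generated_subgroup (ab : gT * gT) : {group gT} :=
  <<[set ab.1; ab.2]>>%G.

Local Notation d := (fibre_card generated_subgroup).

Lemma degree_sgb_pair ab : degree (inl ab : sgb_graph gT) = 1%N.
Proof.
rewrite /degree -(cards1 (inr (generated_subgroup ab) : sgb_graph gT)).
by congr #|pred_of_set _|; apply/setP=> -[cd | H]; rewrite !inE.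
Qed.

Lemma degree_sgb_subgroup H : degree (inr H : sgb_graph gT) = d H.
Proof.
rewrite /degree /fibre_card.
have inl_inj : injective (inl : gT * gT -> sgb_graph gT) by move=> x y [].
rewrite -(card_imset _ inl_inj); congr #|pred_of_set _|.
apply/setP=> -[ab | K]; rewrite !inE /=.
  by rewrite mem_imset // inE eq_sym.
by apply/esym/imsetP=> -[].
Qed.

Lemma adjacency_sgb :
  adjacency_mx (sgb_graph gT) =
  function_graph_mx generated_subgroup 0 1 (fun=> 0).
Proof.
apply/matrixP=> i j; rewrite !mxE.
case: (enum_val i) => [ab | H]; case: (enum_val j) => [cd | K] /=;
  by rewrite ?mul0rn // eq_sym.
Qed.

Lemma degree_mx_sgb :
  degree_mx (sgb_graph gT) =
  function_graph_mx generated_subgroup 1 0 (fun H => (d H)%:R).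
Proof.
apply/matrixP=> i j; rewrite !mxE -(inj_eq enum_val_inj).
case: (enum_val i) => [ab | H]; case: (enum_val j) => [cd | K] /=;
  by rewrite ?degree_sgb_pair ?degree_sgb_subgroup ?mul0rn.
Qed.

Lemma energy_sgb : energy (sgb_graph gT) = \sum_H sqrtC (d H)%:R *+ 2.
Proof.
pose r H : algC := sqrtC (d H)%:R.
have := @sum_eigenvalues_function_graph _ _ generated_subgroup 0 1 (fun=> 0)
  r (fun H => - r H) _ (fun z => `|z|).
rewrite !normr0 !mul0rn addr0 add0r => sum_eig.
rewrite /energy adjacency_sgb; apply: etrans (sum_eig _ _) _ => [H|H|].
- by rewrite subrr addr0.
- by rewrite mulr0 sub0r expr1n mulrN -expr2 sqrtCK.
by apply: eq_bigr => H _; rewrite normrN ger0_norm ?sqrtC_ge0 ?ler0n.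
Qed.

(** The right-hand side does not depend on s, which covers D - A and D + A at
    once: only s ^+ 2 enters the characteristic polynomial of a bipartite
    matrix. *)
Lemma laplacian_type_energy_sgb (s c : algC) : s ^+ 2 = 1 ->
  \sum_(z <- eigenvalues (degree_mx (sgb_graph gT)
                          + s *: adjacency_mx (sgb_graph gT))) `|z - c|
  = \sum_(H : {group gT}) star_laplacian_term c (d H).
Proof.
move=> s2; rewrite adjacency_sgb degree_mx_sgb function_graph_mxDZ //.
have /= := @sum_eigenvalues_function_graph _ _ generated_subgroup 1 s
  (fun H => (d H)%:R) (fun=> 0) (fun H => (d H).+1%:R) _ (fun z => `|z - c|).
move=> sum_eig; apply: (addIr (`|1 - c| *+ #|{group gT}|)).
rewrite sum_eig => [|H|H]; last 2 first.
- by rewrite add0r -[(d H).+1]addn1 natrD addrC.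
- by rewrite s2 mul0r mul1r subrr.
(* The fibres partition the pairs, so the terms [`|1 - c| *+ d H] add up to the
   multiplicity of the eigenvalue 1 before cancellation. *)
rewrite [in RHS]big_split /= sumrB addrAC sumr_const subrK sub0r normrN.
congr (_ + _); rewrite sumrMnr -sum1_card; congr (_ *+ _).
rewrite (partition_big generated_subgroup xpredT) //=.
by apply: eq_bigr => H _; rewrite sum1_card /fibre_card cardsE.
Qed.

End SubgroupGeneratingBipartiteGraph.

(** * Comparison of the energies *)

(** The difference of the two sides is (sqrt d - 1)^2. *)
Lemma leif_sqrtC_nat (d : nat) :
  sqrtC d%:R *+ 2 <= (d.+1%:R : algC) ?= iff (d == 1%N).
Proof.
set r := sqrtC _.
have -> : d.+1%:R = r *+ 2 + (r - 1) ^+ 2.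
  by rewrite -[d.+1]addn1 natrD -[d%:R]sqrtCK -/r; ring.
have r_ge0 : 0 <= r by rewrite sqrtC_ge0 ler0n.
split; first by rewrite lerDl real_exprn_even_ge0 // rpredB ?rpred1 ?ger0_real.
rewrite -subr_eq0 opprD addNKr oppr_eq0 expf_eq0 subr_eq0 /=.
by rewrite -(eqrXn2 (n := 2)) ?ler01 // expr1n sqrtCK pnatr_eq1.
Qed.

Lemma succ_le_star_laplacian_term (d : nat) (c : algC) : (0 < d)%N ->
  d.+1%:R <= star_laplacian_term c d.
Proof.
case: d => // d _; rewrite /star_laplacian_term.
rewrite [`|_| *+ _.+1]mulrS [X in X + _]addrAC subrr add0r.
rewrite -[X in X <= _]add0r lerD ?mulrn_wge0 //.
rewrite -[X in X <= _]ger0_norm ?ler0n //.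
by rewrite -{1}[_.+2%:R](subrK c) addrC ler_normD.
Qed.

Lemma energy_le_star_laplacian_term (d : nat) (c : algC) :
  sqrtC d%:R *+ 2 <= star_laplacian_term c d.
Proof.
case: (posnP d) => [-> | d_gt0].
  rewrite /star_laplacian_term sqrtC0 mul0rn mulr0n sub0r.
  by rewrite addrCA addNr addr0.
exact: le_trans (leif_sqrtC_nat d) (succ_le_star_laplacian_term c d_gt0).
Qed.

Lemma laplacian_energy_sgb (gT : finGroupType) :
  laplacian_energy (sgb_graph gT) =
  \sum_H star_laplacian_term (average_degree (sgb_graph gT))
            (fibre_card (@generated_subgroup gT) H).
Proof.
rewrite /laplacian_energy -scaleN1r.
by rewrite laplacian_type_energy_sgb ?sqrrN ?expr1n.
Qed.

Lemma laplacian_energy_sgb_signless (gT : finGroupType) :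
  laplacian_energy (sgb_graph gT) = signless_laplacian_energy (sgb_graph gT).
Proof.
rewrite laplacian_energy_sgb /signless_laplacian_energy -[adjacency_mx _]scale1r.
by rewrite laplacian_type_energy_sgb ?expr1n.
Qed.

(** Nontriviality cannot be dropped: for the trivial group both energies are
    2. *)
Lemma energy_lt_laplacian_energy_sgb (gT : finGroupType) (x : gT) :
  x != 1%g -> energy (sgb_graph gT) < laplacian_energy (sgb_graph gT).
Proof.
move=> nt_x; rewrite energy_sgb laplacian_energy_sgb /=.
pose X : {group gT} := <[x]>%G.
have dX : (1 < fibre_card (@generated_subgroup gT) X)%N.
  apply: leq_trans (_ : #|[set (x, 1%g); (1%g, x)]| <= _)%N.
    by rewrite cards2 xpair_eqE (negPf nt_x).
  apply: subset_leq_card; apply/subsetP=> ab.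
  by rewrite !inE => /orP[] /eqP-> /=; rewrite -val_eqE /= ?[[set 1%g; _]]setUC;
    rewrite eqEsubset gen_subG subUset !sub1set group1 cycle_id genS ?subsetUl.
rewrite (bigD1 X) //= [ltRHS](bigD1 X) //= ltr_leD //.
  apply: lt_le_trans (succ_le_star_laplacian_term _ (ltnW dX)).
  by rewrite (lt_leif (leif_sqrtC_nat _)) gtn_eqF.
by apply: ler_sum => H _; apply: energy_le_star_laplacian_term.
Qed.

(** Sending a to 1 and b to the generator of Z/2 respects the relations, so Z/2
    is a quotient of the dicyclic group. *)
Lemma dicyclic_nontrivial (gT : finGroupType) m :
  dicyclic gT m -> exists x : gT, x != 1%g.
Proof.
move=> dic; suff /trivgPn[x _ nt_x] : [set: gT] != 1%g by exists x.
apply/eqP=> trivG; move: dic; rewrite /dicyclic trivG => dic.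
have := dic _ [set: 'I_2]%G.
have Z2_homg_dic : ([set: 'I_2] \homg Grp (a : b :
    a ^+ (2 * m) = 1, b ^+ 2 = a ^+ m, b * a * b^-1 = a^-1))%g.
  apply/existsP; exists (1%g, Zp1).
  rewrite /= !expg1n mulg1 mulgV invg1 cycle1 joing1G.
  apply/eqP; congr (_, (_, (_, _))); last exact: val_inj.
  exact/esym/Zp_cycle.
by rewrite Z2_homg_dic => /card_homg; rewrite cards1 cardsT card_ord.
Qed.

Theorem theorem4p7 (p : nat) (gT : finGroupType) :
  prime p -> dicyclic gT p ->
  energy (sgb_graph gT) < laplacian_energy (sgb_graph gT) /\
  laplacian_energy (sgb_graph gT) = signless_laplacian_energy (sgb_graph gT).
Proof.
move=> _ /dicyclic_nontrivial[x nt_x]; split.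
  exact: energy_lt_laplacian_energy_sgb nt_x.
exact: laplacian_energy_sgb_signless.
Qed.
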